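(* Let $K$ be a field of characteristic zero and consider the dialgebra $K[x,y]$. For every $p(x,y)\in K[x,y]$, $$\mathrm{Ad}_{p(x,y)}(h(x,y))=p(x,y)\big(h(x,x)-h(y,y)\big)\quad\text{for all } h(x,y)\in K[x,y],$$ and therefore $\mathrm{Ad}_{p(x,y)}(K[x,y])\subseteq (K[x,y])^{ann}$. Conversely, if $p(x,y)\in K[x,y]$ and $\delta$ is a linear transformation of $K[x,y]$ satisfying $\delta(h(x,y))=p(x,y)\big(h(x,x)-h(y,y)\big)$ for all $h(x,y)\in K[x,y]$, then $\delta=\mathrm{Ad}_{p(x,y)}$.
   Context: The polynomial space $K[x,y]$ in two commuting variables is a dialgebra (a vector space with two bilinear associative products $\vdash,\dashv$ satisfying $u\dashv(v\dashv w)=u\dashv(v\vdash w)$, $(u\dashv v)\vdash w=(u\vdash v)\vdash w$, $u\vdash(v\dashv w)=(u\vdash v)\dashv w$) under the products $f(x,y)\dashv g(x,y)=f(x,y)\,g(y,y)$ and $f(x,y)\vdash g(x,y)=f(x,x)\,g(x,y)$. For a dialgebra $\mathcal{D}$ and $a\in\mathcal{D}$, $\mathrm{Ad}_a:\mathcal{D}\to\mathcal{D}$ is the linear map $\mathrm{Ad}_a(b)=b\vdash a-a\dashv b$ (an inner diderivation). The annihilator $\mathcal{D}^{ann}$ is the linear span of all elements $a\dashv b-a\vdash b$ with $a,b\in\mathcal{D}$. *)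

(* Defs.v *)
From HB Require Import structures.
From mathcomp Require Import all_boot all_order all_algebra.
From mathcomp.multinomials Require Import mpoly.

Set Implicit Arguments.
Unset Strict Implicit.
Unset Printing Implicit Defensive.

Import GRing.Theory.
Local Open Scope ring_scope.

Reserved Notation "a ⊣ b" (at level 45, no associativity).
Reserved Notation "a ⊢ b" (at level 45, no associativity).

HB.mixin Record Lmodule_isDialgebra (K : fieldType) V of GRing.Lmodule K V := {
  dashv : V -> V -> V;
  vdash : V -> V -> V;
  dashv_linearl : forall w, linear (dashv^~ w);
  dashv_linearr : forall u, linear (dashv u);
  vdash_linearl : forall w, linear (vdash^~ w);
  vdash_linearr : forall u, linear (vdash u);
  dashvA : associative dashv;
  vdashA : associative vdash;
  dashv_bar : forall u v w, dashv u (dashv v w) = dashv u (vdash v w);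
  vdash_bar : forall u v w, vdash (dashv u v) w = vdash (vdash u v) w;
  vdash_dashvA : forall u v w, vdash u (dashv v w) = dashv (vdash u v) w
}.

#[short(type="dialgType")]
HB.structure Definition Dialgebra (K : fieldType) :=
  { V of GRing.Lmodule K V & Lmodule_isDialgebra K V }.

Notation "a ⊣ b" := (dashv a b) : ring_scope.
Notation "a ⊢ b" := (vdash a b) : ring_scope.

Section DialgebraNotions.
Variables (K : fieldType) (D : dialgType K).

Definition Ad (a b : D) : D := b ⊢ a - a ⊣ b.

Lemma Ad_is_linear a : linear (Ad a).
Proof.
by move=> k u v; rewrite /Ad vdash_linearl dashv_linearr opprD addrACA scalerBr.
Qed.

HB.instance Definition _ a :=
  GRing.isLinear.Build K D D *:%R (Ad a) (Ad_is_linear a).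

Definition lin_span (S : D -> Prop) (v : D) : Prop :=
  exists n (c : 'I_n -> K) (s : 'I_n -> D),
    (forall i, S (s i)) /\ v = \sum_(i < n) c i *: s i.

Definition ann : D -> Prop := lin_span (fun v => exists a b, v = a ⊣ b - a ⊢ b).

End DialgebraNotions.

Section TwoVariables.
Variable K : fieldType.
Implicit Types f g h c : {mpoly K[2]}.

Definition varx : {mpoly K[2]} := 'X_0.
Definition vary : {mpoly K[2]} := 'X_1.

(* subst2 f a b is f(a, b) *)
Definition subst2 f (a b : {mpoly K[2]}) : {mpoly K[2]} := f \mPo [tuple a; b].

Definition pdashv f g : {mpoly K[2]} := f * subst2 g vary vary.
Definition pvdash f g : {mpoly K[2]} := subst2 f varx varx * g.

Lemma subst2D a b f g : subst2 (f + g) a b = subst2 f a b + subst2 g a b.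
Proof. exact: comp_mpolyD. Qed.

Lemma subst2Z a b k f : subst2 (k *: f) a b = k *: subst2 f a b.
Proof. exact: comp_mpolyZ. Qed.

Lemma subst2M a b f g : subst2 (f * g) a b = subst2 f a b * subst2 g a b.
Proof. exact: rmorphM. Qed.

Lemma subst2x a b : subst2 varx a b = a.
Proof. by rewrite /subst2 comp_mpolyXU. Qed.

Lemma subst2y a b : subst2 vary a b = b.
Proof. by rewrite /subst2 comp_mpolyXU. Qed.

Lemma subst2_comp h c1 c2 a b :
  subst2 (subst2 h c1 c2) a b = subst2 h (subst2 c1 a b) (subst2 c2 a b).
Proof.
rewrite {2 3}/subst2 !comp_mpolyEX {1}/subst2 raddf_sum /=.
apply: eq_bigr => m _; rewrite comp_mpolyZ !comp_mpolyX !big_ord_recl !big_ord0.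
by rewrite !mulr1 rmorphM !rmorphXn.
Qed.

Lemma pdashv_linearl g : linear (pdashv^~ g).
Proof. by move=> k u v; rewrite /pdashv mulrDl scalerAl. Qed.

Lemma pdashv_linearr f : linear (pdashv f).
Proof. by move=> k u v; rewrite /pdashv subst2D subst2Z mulrDr scalerAr. Qed.

Lemma pvdash_linearl g : linear (pvdash^~ g).
Proof. by move=> k u v; rewrite /pvdash subst2D subst2Z mulrDl scalerAl. Qed.

Lemma pvdash_linearr f : linear (pvdash f).
Proof. by move=> k u v; rewrite /pvdash mulrDr scalerAr. Qed.

Lemma pdashvA : associative pdashv.
Proof.
by move=> u v w; rewrite /pdashv subst2M subst2_comp !subst2y mulrA.
Qed.

Lemma pvdashA : associative pvdash.
Proof.
by move=> u v w; rewrite /pvdash subst2M subst2_comp !subst2x mulrA.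
Qed.

Lemma pdashv_bar u v w : pdashv u (pdashv v w) = pdashv u (pvdash v w).
Proof. by rewrite /pdashv /pvdash !subst2M !subst2_comp subst2x !subst2y. Qed.

Lemma pvdash_bar u v w : pvdash (pdashv u v) w = pvdash (pvdash u v) w.
Proof. by rewrite /pdashv /pvdash !subst2M !subst2_comp !subst2x subst2y. Qed.

Lemma pvdash_dashvA u v w : pvdash u (pdashv v w) = pdashv (pvdash u v) w.
Proof. by rewrite /pdashv /pvdash mulrA. Qed.

HB.instance Definition _ := Lmodule_isDialgebra.Build K {mpoly K[2]}
  pdashv_linearl pdashv_linearr pvdash_linearl pvdash_linearr
  pdashvA pvdashA pdashv_bar pvdash_bar pvdash_dashvA.

End TwoVariables.

Arguments varx {K}.
Arguments vary {K}.

(* Main.v *)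
Require Import Defs.
From HB Require Import structures.
From mathcomp Require Import all_boot all_order all_algebra.
From mathcomp.multinomials Require Import mpoly.
Import GRing.Theory.
Local Open Scope ring_scope.

(** The formula for [Ad p h] is the definition of the two products together
    with commutativity, and the converse restates it.  The inclusion in the
    annihilator comes from writing [Ad p h] as a difference of two of its
    generators.  For [A := h(x,x)] one has [A(x,x) = A] and [A(y,y) = h(y,y)],
    so that
      (p A) ⊣ 1 - (p A) ⊢ 1 = p A - p(x,x) A,
      p ⊣ A - p ⊢ A = p h(y,y) - p(x,x) A,
    and subtracting these gives [p (h(x,x) - h(y,y))]. *)

Lemma Ad_mpoly2E (K : fieldType) (p h : {mpoly K[2]}) :
  Ad p h = p * (subst2 h varx varx - subst2 h vary vary).
Proof. by rewrite mulrBr [p * subst2 h varx varx]mulrC. Qed.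

Lemma ann_genB (K : fieldType) (D : dialgType K) (a b c d : D) :
  ann ((a ⊣ b - a ⊢ b) - (c ⊣ d - c ⊢ d)).
Proof.
exists 2, (fun i => if i == 0 then 1 else -1),
  (fun i => if i == 0 then a ⊣ b - a ⊢ b else c ⊣ d - c ⊢ d); split.
  by move=> i; case: (i == 0); [exists a, b | exists c, d].
by rewrite !big_ord_recl big_ord0 /= scale1r scaleN1r addr0.
Qed.

Lemma Ad_mpoly2_genB (K : fieldType) (p h : {mpoly K[2]})
    (A := subst2 h varx varx) :
  Ad p h = ((p * A) ⊣ 1 - (p * A) ⊢ 1) - (p ⊣ A - p ⊢ A).
Proof.
have subst2_1 : subst2 (1 : {mpoly K[2]}) vary vary = 1 by exact: rmorph1.
have Axx : subst2 A varx varx = A by rewrite subst2_comp subst2x.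
have Ayy : subst2 A vary vary = subst2 h vary vary.
  by rewrite subst2_comp subst2x.
rewrite Ad_mpoly2E -/A /dashv /vdash /= /pdashv /pvdash.
by rewrite subst2_1 subst2M Axx Ayy !mulr1 mulrBr opprB addrA subrK.
Qed.

Theorem lemma6p7 (K : fieldType) (charK0 : [pchar K] =i pred0)
    (p : {mpoly K[2]}) :
  [/\ forall h : {mpoly K[2]},
        Ad p h = p * (subst2 h varx varx - subst2 h vary vary),
      forall h : {mpoly K[2]}, ann (Ad p h)
    & forall delta : {linear {mpoly K[2]} -> {mpoly K[2]}},
        (forall h : {mpoly K[2]},
           delta h = p * (subst2 h varx varx - subst2 h vary vary)) ->
        delta =1 Ad p].
Proof.
split=> [h|h|delta deltaE h]; first exact: Ad_mpoly2E.
  by rewrite Ad_mpoly2_genB; exact: ann_genB.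
by rewrite deltaE Ad_mpoly2E.
Qed.
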